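(* In the setting and under the assumptions of the context, let $\mu>0$, let $x_t\in\mathbb R^{d_x}$ be the current iterate, let $v_t$ be uniformly distributed on the unit sphere $\mathbb S^{d_x}$ (independently of $x_t$), and define $$H_t=\tfrac{d_x}{2\mu}\big(y^*(x_t+\mu v_t)-y^*(x_t-\mu v_t)\big)v_t^\top,\qquad g_t=\nabla_xf(x_t,y^*(x_t))+H_t^\top\nabla_yf(x_t,y^*(x_t)),$$ $$\tilde g_t=\tfrac{d_x}{2\mu}\big[f(x_t+\mu v_t,y^*(x_t+\mu v_t))-f(x_t-\mu v_t,y^*(x_t-\mu v_t))\big]v_t .$$ Then $$\mathbb E[\|g_t\|^2\mid x_t]\le k_2d_xL_f^2L_y^2+L_f^2(1+2L_y),$$ $$\mathbb E[\|\tilde g_t\|^2\mid x_t]\le k_2d_xL_f^2L_y^2+k_2d_xL_f^2(1+2L_y),$$ where $k_2\ge1$ is the universal constant described in the context, and the first bound is no larger than the second for $d_x\ge1$.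
   Context: Setting. Let $d_x,d_y\ge1$, $f:\mathbb R^{d_x}\times\mathbb R^{d_y}\to\mathbb R$, $G:\mathbb R^{d_x}\times\mathbb R^{d_y}\to\mathbb R^{d_y}$, and $\mathcal Y\subseteq\mathbb R^{d_y}$ closed and convex. For each $x\in\mathbb R^{d_x}$ the variational inequality ''find $y\in\mathcal Y$ with $\langle G(x,y),y'-y\rangle\ge0$ for all $y'\in\mathcal Y$'' is assumed to have a unique solution, denoted $y^*(x)$. Norms are Euclidean; $\mathbb S^{d_x}=\{v\in\mathbb R^{d_x}:\|v\|=1\}$. Assumption 1: for the given initial point $x_0$ there is $\Delta>0$ with $f(x_0,y^*(x_0))-\inf_xf(x,y^*(x))\le\Delta$. Assumption 2: (i) $f$ is $L_f$-Lipschitz with $\|\nabla_xf\|,\|\nabla_yf\|\le L_f$; (ii) $f$ is differentiable with $L_g$-Lipschitz gradient; (iii) $y^*$ is $L_y$-Lipschitz. The constant $k_2$: a universal constant (its existence is a known result of Shamir, 2017, Lemma 10) such that for every $d\ge1$, $L\ge0$, $\mu>0$, every $L$-Lipschitz $h:\mathbb R^d\to\mathbb R$ and every $x\in\mathbb R^d$, with $v$ uniform on the unit sphere of $\mathbb R^d$, $\mathbb E\big[\|\tfrac{d}{2\mu}(h(x+\mu v)-h(x-\mu v))v\|^2\big]\le k_2dL^2$. *)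

(* Defs.v *)
(* Vectors of R^n are column vectors 'cV[R]_n. *)
From mathcomp Require Export all_boot all_order all_algebra.
From mathcomp Require Export all_classical all_reals all_analysis.

Set Implicit Arguments.
Unset Strict Implicit.
Unset Printing Implicit Defensive.

Import Order.TTheory GRing.Theory Num.Theory.
Import numFieldNormedType.Exports.

Local Open Scope classical_set_scope.
Local Open Scope ring_scope.

Definition dotp (R : realType) (n : nat) (u v : 'cV[R]_n) : R :=
  \sum_i u i ord0 * v i ord0.

(* The library norm `|v| on matrices is the sup norm (same topology, but other
   Lipschitz constants and another unit sphere), hence a separate definition. *)
Definition enorm (R : realType) (n : nat) (v : 'cV[R]_n) : R :=
  Num.sqrt (dotp v v).

Definition elipschitz (R : realType) (n m : nat) (L : R)
    (F : 'cV[R]_n -> 'cV[R]_m) : Prop :=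
  forall x x', enorm (F x - F x') <= L * enorm (x - x').

Definition elipschitz_fun (R : realType) (n : nat) (L : R)
    (h : 'cV[R]_n -> R) : Prop :=
  forall x x', `|h x - h x'| <= L * enorm (x - x').

(* The Euclidean space R^n x R^m is identified with R^(n + m) through col_mx. *)
Definition elipschitz_fun2 (R : realType) (n m : nat) (L : R)
    (f : 'cV[R]_n -> 'cV[R]_m -> R) : Prop :=
  forall x x' y y',
    `|f x y - f x' y'| <= L * enorm (col_mx (x - x') (y - y')).

Definition grad (R : realType) (n : nat) (h : 'cV[R]_n -> R) (x : 'cV[R]_n) :
    'cV[R]_n :=
  \col_i 'D_(delta_mx i ord0) h x.

Definition gradx (R : realType) (n m : nat) (f : 'cV[R]_n -> 'cV[R]_m -> R)
    (x : 'cV[R]_n) (y : 'cV[R]_m) : 'cV[R]_n :=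
  grad (fun x' => f x' y) x.

Definition grady (R : realType) (n m : nat) (f : 'cV[R]_n -> 'cV[R]_m -> R)
    (x : 'cV[R]_n) (y : 'cV[R]_m) : 'cV[R]_m :=
  grad (f x) y.

Definition gradient_elipschitz (R : realType) (n m : nat) (L : R)
    (f : 'cV[R]_n -> 'cV[R]_m -> R) : Prop :=
  forall x x' y y',
    enorm (col_mx (gradx f x y) (grady f x y)
           - col_mx (gradx f x' y') (grady f x' y'))
    <= L * enorm (col_mx (x - x') (y - y')).

Definition vi_solution (R : realType) (n m : nat)
    (G : 'cV[R]_n -> 'cV[R]_m -> 'cV[R]_m) (Y : set 'cV[R]_m)
    (x : 'cV[R]_n) (y : 'cV[R]_m) : Prop :=
  Y y /\ forall y', Y y' -> 0 <= dotp (G x y) (y' - y).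

(* R^n with its Borel sigma-algebra. *)
Notation borel_cV R n := (g_sigma_algebraType (@open 'cV[R]_n)).

(* The uniform distribution on the unit sphere is the unique Borel probability
   measure carried by the sphere that is invariant under the orthogonal group. *)
Definition sphere_uniform (R : realType) (n : nat)
    (nu : probability (borel_cV R n) R) : Prop :=
  nu [set v : 'cV[R]_n | enorm v = 1] = 1%E /\
  forall Q : 'M[R]_n, Q^T *m Q = 1%:M ->
  forall B : set (borel_cV R n), measurable B ->
    nu [set v | B (Q *m v)] = nu B.

Definition two_point (R : realType) (n : nat) (mu : R) (h : 'cV[R]_n -> R)
    (x v : 'cV[R]_n) : 'cV[R]_n :=
  (n%:R / (2 * mu) * (h (x + mu *: v) - h (x - mu *: v))) *: v.

(* Second moment bound for the symmetric two-point estimator, with a constant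
   that does not depend on the dimension (O. Shamir, JMLR 2017, Lemma 10). *)
Definition shamir_constant (R : realType) (k2 : R) : Prop :=
  forall (n : nat) (L mu : R) (h : 'cV[R]_n -> R) (x : 'cV[R]_n)
    (nu : probability (borel_cV R n) R),
    (1 <= n)%N -> 0 <= L -> 0 < mu -> elipschitz_fun L h ->
    sphere_uniform nu ->
    (\int[nu]_v (enorm (two_point mu h x v) ^+ 2)%:E
       <= (k2 * n%:R * L ^+ 2)%:E)%E.

Definition independent_RV (R : realType) (d d1 d2 : measure_display)
    (T : measurableType d) (T1 : measurableType d1) (T2 : measurableType d2)
    (P : probability T R) (X : {RV P >-> T1}) (V : {RV P >-> T2}) : Prop :=
  forall (A : set T1) (B : set T2), measurable A -> measurable B ->
    P (X @^-1` A `&` V @^-1` B) = (P (X @^-1` A) * P (V @^-1` B))%E.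

Definition sigma_RV (R : realType) (d d1 : measure_display)
    (T : measurableType d) (T1 : measurableType d1)
    (P : probability T R) (X : {RV P >-> T1}) : set (set T) :=
  preimage_set_system setT X measurable.

(* Z is a version of the conditional expectation E[Y | X]. *)
Definition cond_expectation (R : realType) (d d1 : measure_display)
    (T : measurableType d) (T1 : measurableType d1)
    (P : probability T R) (X : {RV P >-> T1}) (Y Z : T -> R) : Prop :=
  [/\ P.-integrable setT (EFin \o Y),
      P.-integrable setT (EFin \o Z),
      forall B : set R, measurable B -> sigma_RV X (Z @^-1` B)
    & forall A, sigma_RV X A ->
        (\int[P]_(w in A) (Z w)%:E = \int[P]_(w in A) (Y w)%:E)%E].

Definition jac_estimate (R : realType) (n m : nat) (mu : R)
    (ystar : 'cV[R]_n -> 'cV[R]_m) (x v : 'cV[R]_n) : 'M[R]_(m, n) :=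
  (n%:R / (2 * mu)) *: ((ystar (x + mu *: v) - ystar (x - mu *: v)) *m v^T).

Definition grad_estimate (R : realType) (n m : nat) (mu : R)
    (f : 'cV[R]_n -> 'cV[R]_m -> R) (ystar : 'cV[R]_n -> 'cV[R]_m)
    (x v : 'cV[R]_n) : 'cV[R]_n :=
  gradx f x (ystar x) + (jac_estimate mu ystar x v)^T *m grady f x (ystar x).

Definition zo_grad_estimate (R : realType) (n m : nat) (mu : R)
    (f : 'cV[R]_n -> 'cV[R]_m -> R) (ystar : 'cV[R]_n -> 'cV[R]_m)
    (x v : 'cV[R]_n) : 'cV[R]_n :=
  two_point mu (fun z => f z (ystar z)) x v.

(* Main.v *)
Require Import Defs.
From mathcomp Require Import all_boot all_order all_algebra.
From mathcomp Require Import all_classical all_reals all_analysis.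
From mathcomp Require Import measurable_realfun ring lra.

Set Implicit Arguments.
Unset Strict Implicit.
Unset Printing Implicit Defensive.

Import Order.TTheory GRing.Theory Num.Theory.
Import numFieldNormedType.Exports.

Local Open Scope classical_set_scope.
Local Open Scope ring_scope.

(** The cross term of E|g|^2 is twice the inner product of a = grad_x f with the mean of
    the two-point estimator of h = <grad_y f, y*(.)>.  That mean is a smoothed gradient
    and has norm at most Lip(h); this is proved without Stokes' theorem, by averaging
    over the orthogonal reflection along a and using E<u,v>^2 = 1/n for unit u.  The
    squared terms are Shamir's bound, applied to h and to z |-> f(z, y*(z)), and
    1 <= k2 is Shamir's bound applied to a linear function.  Conditioning on x_t
    amounts to integrating out v_t, by independence and Tonelli. *)

(** * Euclidean inner product and norm *)

Lemma dotpE (R : realType) n (u v : 'cV[R]_n) : dotp u v = (u^T *m v) ord0 ord0.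
Proof. by rewrite mxE; apply: eq_bigr => i _; rewrite mxE. Qed.

Lemma dotpC (R : realType) n (u v : 'cV[R]_n) : dotp u v = dotp v u.
Proof. by apply: eq_bigr => i _; rewrite mulrC. Qed.

Lemma dotpDl (R : realType) n (u v w : 'cV[R]_n) :
  dotp (u + v) w = dotp u w + dotp v w.
Proof. by rewrite -big_split; apply: eq_bigr => i _; rewrite mxE mulrDl. Qed.

Lemma dotpZl (R : realType) n a (u v : 'cV[R]_n) :
  dotp (a *: u) v = a * dotp u v.
Proof. by rewrite /dotp mulr_sumr; apply: eq_bigr => i _; rewrite mxE mulrA. Qed.

Lemma dotpBl (R : realType) n (u v w : 'cV[R]_n) :
  dotp (u - v) w = dotp u w - dotp v w.
Proof. by rewrite -scaleN1r dotpDl dotpZl mulN1r. Qed.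

Lemma dotpDr (R : realType) n (u v w : 'cV[R]_n) :
  dotp u (v + w) = dotp u v + dotp u w.
Proof. by rewrite dotpC dotpDl !(dotpC _ u). Qed.

Lemma dotpZr (R : realType) n a (u v : 'cV[R]_n) :
  dotp u (a *: v) = a * dotp u v.
Proof. by rewrite dotpC dotpZl dotpC. Qed.

Lemma dotpBr (R : realType) n (u v w : 'cV[R]_n) :
  dotp u (v - w) = dotp u v - dotp u w.
Proof. by rewrite dotpC dotpBl !(dotpC _ u). Qed.

Lemma dotp_mulmx (R : realType) m n (A : 'M[R]_(m, n)) u v :
  dotp (A *m u) v = dotp u (A^T *m v).
Proof. by rewrite !dotpE trmx_mul mulmxA. Qed.

Lemma dotp_col_mx (R : realType) m n (u u' : 'cV[R]_m) (v v' : 'cV[R]_n) :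
  dotp (col_mx u v) (col_mx u' v') = dotp u u' + dotp v v'.
Proof. by rewrite !dotpE tr_col_mx mul_row_col mxE. Qed.

Lemma dotp_delta (R : realType) n (v : 'cV[R]_n) i :
  dotp (delta_mx i ord0) v = v i ord0.
Proof.
rewrite /dotp (bigD1 i)//= mxE !eqxx mul1r big1 ?addr0// => j ji.
by rewrite mxE (negbTE ji) mul0r.
Qed.

Lemma dotp_ge0 (R : realType) n (v : 'cV[R]_n) : 0 <= dotp v v.
Proof. by apply: sumr_ge0 => i _; rewrite -expr2 sqr_ge0. Qed.

Lemma dotp_eq0 (R : realType) n (v : 'cV[R]_n) : (dotp v v == 0) = (v == 0).
Proof.
apply/idP/eqP => [|->]; last by rewrite /dotp big1// => i _; rewrite mxE mul0r.
rewrite psumr_eq0 => [/allP v0|i _]; last by rewrite -expr2 sqr_ge0.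
apply/colP => i; rewrite mxE; apply/eqP.
by rewrite -sqrf_eq0 expr2; apply: v0; rewrite mem_index_enum.
Qed.

Lemma enorm_ge0 (R : realType) n (v : 'cV[R]_n) : 0 <= enorm v.
Proof. exact: sqrtr_ge0. Qed.

Lemma enorm_sqr (R : realType) n (v : 'cV[R]_n) : enorm v ^+ 2 = dotp v v.
Proof. by rewrite sqr_sqrtr// dotp_ge0. Qed.

Lemma enorm0 (R : realType) n : enorm (0 : 'cV[R]_n) = 0.
Proof. by apply/eqP; rewrite -sqrf_eq0 enorm_sqr dotp_eq0. Qed.

Lemma enormZ (R : realType) n a (v : 'cV[R]_n) : enorm (a *: v) = `|a| * enorm v.
Proof.
by rewrite /enorm dotpZl dotpZr mulrA -expr2 sqrtrM ?sqr_ge0// sqrtr_sqr.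
Qed.

Lemma enorm_delta (R : realType) n (i : 'I_n) :
  enorm (delta_mx i ord0 : 'cV[R]_n) = 1.
Proof. by rewrite /enorm dotp_delta mxE !eqxx sqrtr1. Qed.

Lemma enorm_ge_coord (R : realType) n (v : 'cV[R]_n) i : `|v i ord0| <= enorm v.
Proof.
rewrite -sqrtr_sqr ler_sqrt ?dotp_ge0// /dotp (bigD1 i)//= -expr2 lerDl.
by apply: sumr_ge0 => j _; rewrite -expr2 sqr_ge0.
Qed.

(** The factor [n] is cruder than the optimal square root of [n], but this comparison serves only to
    carry Euclidean Lipschitz bounds over to continuity for the sup norm. *)
Lemma enorm_le_norm (R : realType) n (v : 'cV[R]_n) : enorm v <= n%:R * `|v|.
Proof.
have nv : 0 <= n%:R * `|v| by rewrite mulr_ge0.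
rewrite -(ler_pXn2r (n := 2))// ?nnegrE ?enorm_ge0//.
rewrite enorm_sqr /dotp.
have H i : v i ord0 * v i ord0 <= `|v| ^+ 2.
  rewrite -expr2 -real_normK ?num_real// lerXn2r ?nnegrE//.
  rewrite [leRHS]mx_normrE.
  exact: (le_bigmax _ (fun ij : 'I_n * 'I_1 => `|v ij.1 ij.2|) (i, ord0)).
apply: (le_trans (ler_sum _ (fun i _ => H i))).
rewrite sumr_const card_ord exprMn -[leLHS]mulr_natl ler_wpM2r ?sqr_ge0//.
by rewrite -natrX ler_nat -mulnn; case: (n) => // k; rewrite leq_pmulr.
Qed.

Lemma cauchy_schwarz (R : realType) n (u v : 'cV[R]_n) :
  `|dotp u v| <= enorm u * enorm v.
Proof.
have [->|u0] := eqVneq u 0.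
  by rewrite enorm0 mul0r /dotp big1 ?normr0// => i _; rewrite mxE mul0r.
have uu : 0 < dotp u u by rewrite lt_neqAle eq_sym dotp_eq0 u0 dotp_ge0.
rewrite -sqrtr_sqr -sqrtrM ?dotp_ge0// ler_sqrt ?mulr_ge0 ?dotp_ge0//.
(* The squared norm of this vector is [dotp u u] times the difference of the two sides, squared, of
   the Cauchy-Schwarz inequality. *)
have := dotp_ge0 (dotp u u *: v - dotp u v *: u).
rewrite !(dotpBl, dotpBr, dotpZl, dotpZr) (dotpC v u) => H.
rewrite -(ler_pM2l uu) -subr_ge0; apply: le_trans H _.
by rewrite le_eqVlt; apply/orP; left; apply/eqP; ring.
Qed.

Lemma enorm_col_mx_le (R : realType) m n (u : 'cV[R]_m) (v : 'cV[R]_n) :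
  enorm (col_mx u v) <= enorm u + enorm v.
Proof.
rewrite -(ler_pXn2r (n := 2))// ?nnegrE ?addr_ge0 ?enorm_ge0//.
rewrite enorm_sqr dotp_col_mx sqrrD !enorm_sqr.
by rewrite addrAC lerDl mulrn_wge0// mulr_ge0 ?enorm_ge0.
Qed.

(** Supplies the direction of the reflection used later; for [a = 0] any unit vector will do, and a
    basis vector is taken. *)
Lemma unit_direction (R : realType) n (a : 'cV[R]_n) : (0 < n)%N ->
  exists2 u, enorm u = 1 & a = enorm a *: u.
Proof.
case: n a => // n a _; have [->|a0] := eqVneq a 0.
  by exists (delta_mx ord0 ord0); rewrite ?enorm_delta// enorm0 scale0r.
have na : enorm a != 0 by rewrite -sqrf_eq0 enorm_sqr dotp_eq0.
exists ((enorm a)^-1 *: a); last by rewrite scalerA divff// scale1r.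
by rewrite enormZ ger0_norm ?invr_ge0 ?enorm_ge0// mulVf.
Qed.

(** * Householder reflections *)

(** The reflection across the hyperplane orthogonal to [u]. The quotient makes it independent of the
    length of [u], and for [u = 0] it is the identity. *)
Definition reflection (R : realType) n (u : 'cV[R]_n) : 'M[R]_n :=
  1%:M - (2 / dotp u u) *: (u *m u^T).

Lemma reflectionE (R : realType) n (u v : 'cV[R]_n) :
  reflection u *m v = v - (2 / dotp u u * dotp u v) *: u.
Proof.
rewrite mulmxBl mul1mx -scalemxAl -mulmxA [u^T *m v]mx11_scalar -dotpE.
by rewrite mul_mx_scalar scalerA.
Qed.

Lemma tr_reflection (R : realType) n (u : 'cV[R]_n) :
  (reflection u)^T = reflection u.
Proof.
by rewrite /reflection linearB /= trmx1 linearZ /= trmx_mul trmxK.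
Qed.

(** The matrix is symmetric, so this says that reflecting twice is the identity: the second
    reflection sends [u] to [- u], and the two rank-one corrections cancel. *)
Lemma reflection_orthogonal (R : realType) n (u : 'cV[R]_n) :
  (reflection u)^T *m reflection u = 1%:M.
Proof.
rewrite tr_reflection; have [->|u0] := eqVneq u 0.
  by rewrite /reflection mul0mx scaler0 subr0 mulmx1.
have uu : dotp u u != 0 by rewrite dotp_eq0.
rewrite {2}/reflection mulmxBr mulmx1 -scalemxAr mulmxA reflectionE divfK//.
rewrite mulmxBl -scalemxAl scalerBr scalerA.
rewrite (_ : 2 / dotp u u * 2 = 2 / dotp u u + 2 / dotp u u); last by ring.
by rewrite scalerDl opprB addrK /reflection subrK.
Qed.

(** For unit vectors the squared length of [u - v] is [2 * dotp (u - v) u], so the reflection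
    subtracts exactly [u - v] from [u]. Hence orthogonal maps act transitively on the sphere. *)
Lemma reflection_swap (R : realType) n (u v : 'cV[R]_n) :
  enorm u = 1 -> enorm v = 1 -> reflection (u - v) *m u = v.
Proof.
move=> u1 v1; have [->|uv] := eqVneq u v.
  by rewrite subrr reflectionE scaler0 subr0.
have := enorm_sqr u; have := enorm_sqr v; rewrite u1 v1 expr1n => vv uu.
have uv0 : dotp (u - v) (u - v) != 0 by rewrite dotp_eq0 subr_eq0.
have uvE : dotp (u - v) (u - v) = 2 * dotp (u - v) u.
  by rewrite !(dotpBl, dotpBr) -uu -vv (dotpC v u); ring.
rewrite reflectionE -mulrA (mulrC _^-1) mulrA -uvE divff// scale1r.
by rewrite opprB addrC subrK.
Qed.

(** * Continuity and Borel measurability *)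

Lemma lipschitz_continuous (R : realType) (V W : normedModType R) (K : R)
    (f : V -> W) :
  (forall x y, `|f x - f y| <= K * `|x - y|) -> continuous f.
Proof.
move=> fK x; apply/cvgrPdist_le => e e0.
(* [K] may be zero or negative, so a positive constant is needed before dividing by it. *)
have K0 : 0 < Num.max K 1 by rewrite lt_max ltr01 orbT.
near=> y; apply: (le_trans (fK x y)).
apply: (@le_trans _ _ (Num.max K 1 * `|x - y|)).
  by rewrite ler_wpM2r// le_max lexx.
rewrite mulrC -ler_pdivlMr//.
by near: y; apply: cvgr_dist_le; rewrite ?divr_gt0//; exact: cvg_id.
Unshelve. all: by end_near. Qed.

Lemma norm_le_enorm (R : realType) n (v : 'cV[R]_n) : `|v| <= enorm v.
Proof.
rewrite [leLHS]mx_normrE; apply: bigmax_le; first exact: enorm_ge0.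
by move=> [i j] _ /=; rewrite ord1 enorm_ge_coord.
Qed.

Lemma elipschitz_fun_continuous (R : realType) n K (h : 'cV[R]_n -> R) :
  elipschitz_fun K h -> continuous h.
Proof.
move=> hK; apply: (@lipschitz_continuous _ _ _ (`|K| * n%:R)) => x y.
apply: (le_trans (hK x y)); apply: (@le_trans _ _ (`|K| * enorm (x - y))).
  by rewrite ler_wpM2r ?enorm_ge0// ler_norm.
by rewrite -mulrA ler_wpM2l// enorm_le_norm.
Qed.

Lemma continuous_dotp (R : realType) n (T : topologicalType)
    (u v : T -> 'cV[R]_n) :
  (forall i, continuous (fun t => u t i ord0)) ->
  (forall i, continuous (fun t => v t i ord0)) ->
  continuous (fun t => dotp (u t) (v t)).
Proof.
move=> uc vc; apply: continuous_big => [|i _ t]; last exact: cvgM (uc i t) (vc i t).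
exact: add_continuous.
Qed.

Lemma continuous_measurable_borel_cV (R : realType) n (h : 'cV[R]_n -> R) :
  continuous h -> measurable_fun setT (h : borel_cV R n -> R).
Proof.
move=> /continuousP hc; apply: (measurability _ (RGenOpens.measurableE R)).
move=> _ [_ [a [b ->] <-]]; rewrite setTI.
by apply: sub_sigma_algebra; exact/hc/interval_open.
Qed.

(** An orthogonal matrix preserves [enorm], hence is Lipschitz for the sup norm with constant [n],
    hence continuous. *)
Lemma measurable_mulmx_borel_cV (R : realType) n (Q : 'M[R]_n) :
  Q^T *m Q = 1%:M ->
  measurable_fun setT (mulmx Q : borel_cV R n -> borel_cV R n).
Proof.
move=> QQ; apply: (@measurability _ _ (borel_cV R n) (borel_cV R n) setT _
  (@open 'cV[R]_n)) => //.
move=> _ [A oA <-]; rewrite setTI; apply: sub_sigma_algebra.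
have Qc : continuous (fun v : 'cV[R]_n => Q *m v : 'cV[R]_n).
  apply: (@lipschitz_continuous _ _ _ n%:R) => x y; rewrite -mulmxBr.
  apply: (le_trans (norm_le_enorm _)).
  by rewrite /enorm dotp_mulmx mulmxA QQ mul1mx enorm_le_norm.
by move/continuousP: Qc; apply.
Qed.

(** * The uniform distribution on the sphere *)

Lemma sphere_uniform_ae (R : realType) n (nu : probability (borel_cV R n) R) :
  sphere_uniform nu -> {ae nu, forall v, enorm (v : 'cV[R]_n) = 1}.
Proof.
move=> [nu1 _].
have ms : measurable ([set v : 'cV[R]_n | enorm v = 1] : set (borel_cV R n)).
  (* The sphere is measurable as the preimage of 1 under the continuous squared norm. *)
  rewrite (_ : mkset _ = (fun v : 'cV[R]_n => dotp v v) @^-1` [set 1]); last first.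
    apply/seteqP; split=> v /=; first by rewrite -enorm_sqr => ->; rewrite expr1n.
    by rewrite /enorm => ->; rewrite sqrtr1.
  rewrite -[X in measurable X]setTI; apply: (_ : measurable_fun _ _) => //.
  apply: continuous_measurable_borel_cV.
  by apply: continuous_dotp => i; exact: coord_continuous.
exists (~` [set v : 'cV[R]_n | enorm v = 1]); split => //.
- exact: measurableC.
- by rewrite probability_setC// nu1 subee.
Qed.

(** Change of variables: by invariance on Borel sets, the image of [nu] under [Q] is [nu] itself. *)
Lemma sphere_uniform_invariant (R : realType) n
    (nu : probability (borel_cV R n) R) (Q : 'M[R]_n) (F : 'cV[R]_n -> R) :
  sphere_uniform nu -> Q^T *m Q = 1%:M -> (forall v, 0 <= F v) ->
  measurable_fun setT (F : borel_cV R n -> R) ->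
  (\int[nu]_v (F (Q *m v))%:E = \int[nu]_v (F v)%:E)%E.
Proof.
move=> [_ nuQ] QQ F0 mF.
have mQ := measurable_mulmx_borel_cV QQ.
transitivity (\int[pushforward nu (mulmx Q : borel_cV R n -> borel_cV R n)]_v (F v)%:E)%E.
  rewrite ge0_integral_pushforward//; first exact/measurable_EFinP.
  by move=> v _; rewrite lee_fin.
by apply: eq_measure_integral => A mA _; exact: nuQ.
Qed.

(** * Joint measurability of Caratheodory functions *)

(** Rounding down to the grid of mesh [1 / k.+1] moves each coordinate by at most the mesh, and the
    library norm is the sup norm. *)
Lemma grid_cvg (R : realType) n (x : 'cV[R]_n) :
  (\col_i ((Num.floor (x i ord0 * k.+1%:R))%:~R / k.+1%:R) : 'cV[R]_n)
    @[k --> \oo] --> x.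
Proof.
apply/cvgrPdist_le => e e0; near=> k.
apply: (@le_trans _ _ k.+1%:R^-1); last first.
  by near: k; apply: filterS (near_infty_natSinv_lt (PosNum e0)) => k /ltW.
rewrite [leLHS]mx_normrE; apply: bigmax_le; first by rewrite invr_ge0.
move=> [i j] _ /=; have -> : j = ord0 by exact: ord1.
rewrite !mxE.
set y := x i ord0 * _; have -> : x i ord0 = y / k.+1%:R by rewrite mulfK.
rewrite -mulrBl normrM [X in _ * X]ger0_norm ?invr_ge0// ler_piMl ?invr_ge0//.
have /andP[y1 /ltW y2] := floor_itv y.
by rewrite ger0_norm ?subr_ge0// lerBlDl addrC; rewrite intrD addrC in y2.
Unshelve. all: by end_near. Qed.

(* Caratheodory: [F] is the pointwise limit of the functions obtained by rounding the first
   argument to a countable grid. *)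
Lemma caratheodory_measurable (R : realType) n d2 (T2 : measurableType d2)
    (F : 'cV[R]_n -> T2 -> R) :
  (forall v, continuous (F ^~ v)) -> (forall x, measurable_fun setT (F x)) ->
  measurable_fun setT (fun p : borel_cV R n * T2 => F p.1 p.2).
Proof.
move=> Fc Fm.
(* [fl k x] is the integer label of the grid cell containing [x], and [pt k] returns the lower
   corner of a cell. *)
pose fl k (x : 'cV[R]_n) : 'cV[int]_n := \col_i Num.floor (x i ord0 * k.+1%:R).
pose pt k (q : 'cV[int]_n) : 'cV[R]_n := \col_i ((q i ord0)%:~R / k.+1%:R).
apply: (@measurable_fun_cvg _ _ _ _
  (fun k (p : borel_cV R n * T2) => F (pt k (fl k p.1)) p.2)); last first.
  move=> [x v] _ /=.
  have ptx : pt k (fl k x) @[k --> \oo] --> x.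
    rewrite (_ : (fun k => _) = (fun k =>
        \col_i ((Num.floor (x i ord0 * k.+1%:R))%:~R / k.+1%:R))).
      exact: grid_cvg.
    by apply/funext => k; apply/colP => i; rewrite !mxE.
  exact: (cvg_comp _ _ ptx (Fc v x)).
move=> k _ B mB; rewrite setTI.
have mfl q : measurable ([set x : 'cV[R]_n | fl k x = q] : set (borel_cV R n)).
  rewrite (_ : mkset _ = \bigcap_(i in [set: 'I_n])
      ((fun x : 'cV[R]_n => x i ord0 * k.+1%:R) @^-1`
         `[(q i ord0)%:~R, (q i ord0 + 1)%:~R[%classic)); last first.
    apply/seteqP; split=> x /=.
      by move=> <- i _ /=; rewrite mxE in_itv/= floor_itv.
    move=> H; apply/colP => i; rewrite mxE; apply: floor_def.
    by have := H i I; rewrite /= in_itv.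
  apply: fin_bigcap_measurable => // i _.
  rewrite -[X in measurable X]setTI.
  have : measurable_fun setT
      ((fun x : 'cV[R]_n => x i ord0 * k.+1%:R) : borel_cV R n -> R).
    apply: continuous_measurable_borel_cV => x.
    exact: (cvgM (@coord_continuous R n 1 i ord0 x) (cvg_cst _)).
  by apply.
(* On each of the countably many cells the rounded argument is constant, so the preimage is a
   countable union of measurable rectangles. *)
rewrite (_ : _ @^-1` _ = \bigcup_(q in [set: 'cV[int]_n])
    ([set x : 'cV[R]_n | fl k x = q] `*` (F (pt k q) @^-1` B))); last first.
  apply/seteqP; split => [[x v] /= Bxv|[x v] [q _ [/= <-]]//].
  by exists (fl k x).
apply: countable_bigcupT_measurable => [|q]; first exact: countableP.
by apply: measurableX => //; rewrite -[X in measurable X]setTI; exact: Fm.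
Qed.

(** * Conditional expectation under independence *)

(** One version is [Z0 (X w)], where [Z0] integrates out the second argument against the law of [V];
    it is at most [b] everywhere. Any other version has the same integrals over events of [X], which
    forces the event where it exceeds [b] to be null. *)
Lemma cond_expectation_indep (R : realType) d d1 d2 (T : measurableType d)
    (T1 : measurableType d1) (T2 : measurableType d2) (P : probability T R)
    (X : {RV P >-> T1}) (V : {RV P >-> T2}) (F : T1 -> T2 -> R) (b : R) :
  independent_RV X V ->
  measurable_fun setT (fun p : T1 * T2 => F p.1 p.2) ->
  (forall x v, 0 <= F x v) ->
  (forall x, \int[distribution P V]_v (F x v)%:E <= b%:E)%E ->
  let Y w := F (X w) (V w) in
  (exists Z, cond_expectation X Y Z) /\
  (forall Z, cond_expectation X Y Z -> {ae P, forall w, Z w <= b}).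
Proof.
move=> XV mF F0 Fb Y.
have mX : measurable_fun setT X by [].
have mV : measurable_fun setT V by [].
pose W w := (X w, V w).
have mW : measurable_fun setT W by exact/measurable_fun_pairP.
pose Z0 x := (\int[distribution P V]_v (F x v)%:E)%E.
have Z0_ge0 x : (0 <= Z0 x)%E.
  by apply: integral_ge0 => v _; rewrite lee_fin.
have mFE : measurable_fun setT (fun p : T1 * T2 => (F p.1 p.2)%:E).
  exact/measurable_EFinP.
have mZ0 : measurable_fun setT Z0.
  apply: (@measurable_fun_fubini_tonelli_F _ _ _ _ _ (distribution P V)
    (fun p : T1 * T2 => (F p.1 p.2)%:E)) => //.
  by move=> p; rewrite lee_fin.
have key (B : set T1) : measurable B ->
    (\int[P]_(w in X @^-1` B) (Y w)%:E = \int[P]_(w in X @^-1` B) Z0 (X w))%E.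
  move=> mB.
  (* Extending by zero off [B] turns the integral over the event into an integral against the joint
     law of [X] and [V]. *)
  pose F' := (fun p : T1 * T2 => (F p.1 p.2)%:E) \_ (B `*` setT).
  have mBT : measurable (B `*` setT : set (T1 * T2)) by exact: measurableX.
  have mF' : measurable_fun setT F'.
    by apply/(measurable_restrictT _ mBT); exact: measurable_funTS.
  have F'0 p : (0 <= F' p)%E.
    by rewrite /F' patchE; case: ifPn => // _; rewrite lee_fin.
  transitivity (\int[P]_w F' (W w))%E.
    rewrite integral_mkcond; apply: eq_integral => w _.
    rewrite /F' !patchE; congr (if _ then _ else _).
    by apply/idP/idP; rewrite !inE/=; [split|case].
  transitivity (\int[pushforward P W]_p F' p)%E.
    by rewrite ge0_integral_pushforward.
  (* Independence says that the joint law and the product of the marginals agree on rectangles,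
     which determines the product measure. *)
  transitivity (\int[distribution P X \x distribution P V]_p F' p)%E.
    apply: eq_measure_integral => A mA _; apply/esym.
    by apply: product_measure_unique => // A1 A2 mA1 mA2; exact: XV.
  rewrite fubini_tonelli1//.
  transitivity (\int[distribution P X]_(x in B) Z0 x)%E.
    rewrite [RHS]integral_mkcond; apply: eq_integral => x _.
    rewrite /fubini_F patchE; case: ifPn => [xB|xB].
      apply: eq_integral => v _; rewrite /F' patchE ifT//.
      by rewrite inE; split => //; rewrite inE in xB.
    apply: integral0_eq => v _; rewrite /F' patchE ifF//.
    by apply/negbTE; apply: contraNN xB; rewrite !inE => -[].
  rewrite ge0_integral_pushforward//.
  by apply: measurable_funTS.
have Z0_fin x : Z0 x \is a fin_num.
  by rewrite ge0_fin_numE// (le_lt_trans (Fb x)) ?ltry.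
have mY : measurable_fun setT Y by exact: measurableT_comp mF mW.
have mZ : measurable_fun setT (fun x => fine (Z0 x)).
  exact: measurableT_comp.
have le_b A : measurable A -> (\int[P]_(w in A) Z0 (X w) <= b%:E * P A)%E.
  move=> mA; rewrite -(integral_cst _ mA); apply: ge0_le_integral => //.
  - by apply: measurable_funTS; exact: measurableT_comp.
  - by move=> w _; exact: Fb.
have Z_int : P.-integrable setT (EFin \o (fun w => fine (Z0 (X w)))).
  apply/integrableP; split.
    by apply/measurable_EFinP; exact: measurableT_comp mZ mX.
  apply: (@le_lt_trans _ _ (\int[P]_w Z0 (X w))%E).
    apply: ge0_le_integral => //.
    - apply: measurableT_comp => //.
      by apply/measurable_EFinP; exact: measurableT_comp mZ mX.
    - exact: measurableT_comp.
    - by move=> w _; rewrite /= ger0_norm ?fine_ge0// fineK.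
  by rewrite (le_lt_trans (le_b _ measurableT))// probability_setT mule1 ltry.
have Y_int : P.-integrable setT (EFin \o Y).
  apply/integrableP; split; first exact/measurable_EFinP.
  rewrite (eq_integral (fun w => (Y w)%:E)); last first.
    by move=> w _; rewrite /= ger0_norm// F0.
  have := key _ measurableT; rewrite preimage_setT => ->.
  by rewrite (le_lt_trans (le_b _ measurableT))// probability_setT mule1 ltry.
split.
  exists (fun w => fine (Z0 (X w))); split => //.
    move=> B mB; exists ((fun x => fine (Z0 x)) @^-1` B).
      by rewrite -[X in measurable X]setTI; exact: mZ.
    by rewrite setTI.
  move=> A [B mB <-]; rewrite setTI key//.
  by apply: eq_integral => w _; rewrite fineK.
move=> Z [_ Zi Zs ZY].
(* The event where [Z] exceeds [b] belongs to the sigma-algebra of [X], so the averaging identity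
   applies to it. *)
have [B mB] := Zs `]b, +oo[%classic (measurable_itv _).
rewrite setTI => BA.
have mA : measurable (X @^-1` B) by rewrite -[X in measurable X]setTI; exact: mX.
have ZA : (\int[P]_(w in X @^-1` B) (Z w)%:E <= b%:E * P (X @^-1` B))%E.
  by rewrite ZY ?key ?le_b//; exists B => //; rewrite setTI.
have ZiA : P.-integrable (X @^-1` B) (EFin \o Z) by exact: integrableS Zi.
have bi : P.-integrable (X @^-1` B) (cst b%:E).
  apply: (integrableS measurableT) => //.
  exact: finite_measure_integrable_cst.
have dA w : (X @^-1` B) w -> (0 <= (Z w)%:E - b%:E)%E.
  by rewrite BA /= in_itv/= andbT -EFinB lee_fin subr_ge0 => /ltW.
(* The integrand is nonnegative on this event, while the integral of [Z] there is at most [b] times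
   its probability. *)
have int0 : (\int[P]_(w in X @^-1` B) ((Z w)%:E - b%:E) = 0)%E.
  apply/eqP; rewrite eq_le integral_ge0// andbT.
  by rewrite (integralB mA ZiA bi) integral_cst// sube_le0.
exists (X @^-1` B); split => //; last first.
  by move=> w /negP; rewrite -ltNge => bZ; rewrite BA /= in_itv/= andbT.
have mZA : measurable_fun (X @^-1` B) (fun w => (Z w)%:E - b%:E)%E.
  by apply: emeasurable_funB => //; case/integrableP: ZiA.
have /(ae_eq_integral_abs P mA mZA) [N [mN PN0 AN]] :
    (\int[P]_(w in X @^-1` B) `|(Z w)%:E - b%:E| = 0)%E.
  rewrite -[RHS]int0; apply: eq_integral => w; rewrite inE => /dA wA.
  by rewrite gee0_abs.
(* [Z - b] vanishes on the event outside the null set [N], yet is positive throughout the event, so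
   the event lies in [N]. *)
apply: (subset_measure0 mA mN _ PN0) => w Bw; apply: AN => /= /(_ Bw) /eqP.
apply/negP; rewrite -EFinB eqe subr_eq0 gt_eqF//.
by move: Bw; rewrite BA /= in_itv/= andbT.
Qed.

(** * Second moments of the uniform distribution *)

Lemma measurable_dotp_sqr (R : realType) n (u : 'cV[R]_n) :
  measurable_fun setT ((fun v => dotp u v ^+ 2) : borel_cV R n -> R).
Proof.
apply: measurable_funX; apply: continuous_measurable_borel_cV.
by apply: continuous_dotp => i; [exact: cst_continuous|exact: coord_continuous].
Qed.

(** Invariance makes the second moments along all unit vectors equal, and those along the [n] basis
    vectors add up to the mean of the squared norm, which is 1. *)
Lemma sphere_second_moment (R : realType) n (nu : probability (borel_cV R n) R)
    (u : 'cV[R]_n) :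
  (0 < n)%N -> sphere_uniform nu -> enorm u = 1 ->
  (\int[nu]_v (dotp u v ^+ 2)%:E = (n%:R^-1)%:E)%E.
Proof.
move=> n0 nuU u1.
have sym i : (\int[nu]_v (dotp (delta_mx i ord0) v ^+ 2)%:E =
              \int[nu]_v (dotp u v ^+ 2)%:E)%E.
  set e := delta_mx i ord0.
  (* The reflection along [e - u] exchanges [e] and [u], and being symmetric it moves across
     [dotp]. *)
  rewrite -(@sphere_uniform_invariant _ _ _ (reflection (e - u))
     (fun v => dotp e v ^+ 2))//.
  - apply: eq_integral => v _.
    rewrite -[reflection _]tr_reflection -dotp_mulmx reflection_swap//.
    exact: enorm_delta.
  - exact: reflection_orthogonal.
  - by move=> v; exact: sqr_ge0.
  - exact: measurable_dotp_sqr.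
have sum1 : (\sum_(i < n) \int[nu]_v (dotp (delta_mx i ord0) v ^+ 2)%:E = 1)%E.
  rewrite -ge0_integral_sum//; first last.
  - by move=> i v _; rewrite lee_fin sqr_ge0.
  - by move=> i; apply/measurable_EFinP; exact: measurable_dotp_sqr.
  transitivity (\int[nu]_v (cst 1 v))%E; last first.
    by rewrite integral_cst// mul1e; exact: probability_setT.
  (* The squares of the coordinates sum to 1 only on the sphere, hence almost everywhere. *)
  apply: ge0_ae_eq_integral => //.
  - apply: emeasurable_sum => i; apply/measurable_EFinP; exact: measurable_dotp_sqr.
  - by move=> v _; apply: sume_ge0 => i _; rewrite lee_fin sqr_ge0.
  - have [N [mN N0 subN]] := sphere_uniform_ae nuU.
    exists N; split => // v /= neq; apply: subN => /= v1; apply: neq => _.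
    rewrite sumEFin; congr EFin; rewrite -(expr1n _ 2) -v1 enorm_sqr.
    by apply: eq_bigr => i _; rewrite dotp_delta.
move: sum1; under eq_bigr do rewrite sym -[(\int[nu]_v _)%E]mul1e.
rewrite -ge0_sume_distrl// sumEFin sumr_const card_ord.
(* Finiteness is not known beforehand: an infinite value would make the sum infinite instead of
   1. *)
case: (\int[nu]_v _)%E => [r| |] /=; last 2 first.
- by rewrite mulry gtr0_sg ?ltr0n// mul1e.
- by rewrite mulrNy gtr0_sg ?ltr0n// mul1e.
rewrite -EFinM => -[nr]; congr EFin; apply: (mulfI (_ : n%:R != 0)).
  by rewrite pnatr_eq0 -lt0n.
by rewrite nr divff// pnatr_eq0 -lt0n.
Qed.

(** * Regularity of the two-point estimator and the lower bound on its constant *)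

Lemma dotp_elipschitz (R : realType) n (u : 'cV[R]_n) :
  elipschitz_fun (enorm u) (dotp u).
Proof. by move=> x y; rewrite -dotpBr cauchy_schwarz. Qed.

Lemma elipschitz_fun_shift (R : realType) n L (h : 'cV[R]_n -> R) x a :
  elipschitz_fun L h -> elipschitz_fun (L * `|a|) (fun v => h (x + a *: v)).
Proof.
move=> hL v w; apply: (le_trans (hL _ _)).
by rewrite opprD addrACA subrr add0r -scalerBr enormZ mulrA.
Qed.

Lemma continuous_two_point (R : realType) n L mu (h : 'cV[R]_n -> R) x i :
  elipschitz_fun L h -> continuous (fun v => two_point mu h x v i ord0).
Proof.
move=> hL.
rewrite (_ : (fun _ => _) = fun v : 'cV[R]_n =>
    n%:R / (2 * mu) * (h (x + mu *: v) - h (x + (- mu) *: v)) * v i ord0); last first.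
  by apply/funext => v; rewrite mxE scaleNr.
move=> v; have cp := elipschitz_fun_continuous (elipschitz_fun_shift x mu hL) (x := v).
have cm := elipschitz_fun_continuous (elipschitz_fun_shift x (- mu) hL) (x := v).
exact: cvgM (cvgM (cvg_cst _) (cvgB cp cm)) (@coord_continuous R n 1 i ord0 v).
Qed.

(** The shift [a] will be the partial gradient in [x]; taking [a = 0] gives the bare estimator. *)
Lemma measurable_shifted_two_point (R : realType) n L mu (h : 'cV[R]_n -> R) x a :
  elipschitz_fun L h ->
  measurable_fun setT
    ((fun v => enorm (a + two_point mu h x v) ^+ 2) : borel_cV R n -> R).
Proof.
move=> hL; apply: continuous_measurable_borel_cV.
under eq_fun do rewrite enorm_sqr.
have tc i : continuous (fun v => (a + two_point mu h x v) i ord0).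
  rewrite (_ : (fun _ => _) = fun v => a i ord0 + two_point mu h x v i ord0).
    by move=> v; exact: cvgD (cvg_cst _) (@continuous_two_point R n L mu h x i hL v).
  by apply/funext => v; rewrite mxE.
exact: continuous_dotp.
Qed.

Lemma two_point_dotp (R : realType) n mu (u x v : 'cV[R]_n) : mu != 0 ->
  two_point mu (dotp u) x v = (n%:R * dotp u v) *: v.
Proof.
move=> mu0; rewrite /two_point dotpBr dotpDr dotpZr; congr (_ *: v).
by field.
Qed.

(** For the linear function of a unit vector [u], which is 1-Lipschitz, the estimator is
    [(n%:R * dotp u v) *: v]. Its second moment is [n^2 / n = n], and the assumed bound is
    [k2 * n]. *)
Lemma shamir_constant_ge1 (R : realType) (k2 : R) n
    (nu : probability (borel_cV R n) R) :
  (0 < n)%N -> sphere_uniform nu -> shamir_constant k2 -> 1 <= k2.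
Proof.
move=> n0 nuU /(_ n 1 1 _ 0 nu n0 ler01 ltr01) sh.
have n1 : 0 < n%:R :> R by rewrite ltr0n.
pose u : 'cV[R]_n := delta_mx (Ordinal n0) ord0.
have uL : elipschitz_fun 1 (dotp u).
  by have := dotp_elipschitz u; rewrite enorm_delta.
have := sh _ uL nuU; rewrite expr1n mulr1.
rewrite (@ge0_ae_eq_integral _ _ _ nu _ _
  (fun v => (n%:R ^+ 2)%:E * (dotp u v ^+ 2)%:E)%E)//.
- rewrite ge0_integralZl//.
  + rewrite (sphere_second_moment n0 nuU) ?enorm_delta//.
    by rewrite -EFinM lee_fin expr2 mulfK ?gt_eqF// -{1}[n%:R]mul1r ler_pM2r.
  + by apply/measurable_EFinP; exact: measurable_dotp_sqr.
  + by move=> v _; rewrite lee_fin sqr_ge0.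
- apply/measurable_EFinP; have := measurable_shifted_two_point 1 0 0 uL.
  by under eq_fun do rewrite add0r.
- by apply: emeasurable_funM => //; apply/measurable_EFinP; exact: measurable_dotp_sqr.
- by move=> v _; rewrite lee_fin sqr_ge0.
- by move=> v _; rewrite -EFinM lee_fin mulr_ge0 ?sqr_ge0.
- have [N [mN N0 subN]] := sphere_uniform_ae nuU.
  exists N; split => // v /= neq; apply: subN => /= v1; apply: neq => _.
  by rewrite two_point_dotp// enormZ v1 mulr1 real_normK ?num_real// exprMn EFinM.
Qed.

(** * Second moment of the shifted two-point estimator *)

Lemma ge0_integralD_EFin (R : realType) d (T : measurableType d)
    (nu : {measure set T -> \bar R}) (F H : T -> R) :
  (forall v, 0 <= F v) -> (forall v, 0 <= H v) ->
  measurable_fun setT F -> measurable_fun setT H ->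
  (\int[nu]_v (F v + H v)%:E = \int[nu]_v (F v)%:E + \int[nu]_v (H v)%:E)%E.
Proof.
move=> F0 H0 mF mH; under eq_integral do rewrite EFinD.
apply: ge0_integralD => //.
- by move=> v _; rewrite lee_fin.
- exact/measurable_EFinP.
- by move=> v _; rewrite lee_fin.
- exact/measurable_EFinP.
Qed.

Lemma integral_affine_dotp_sqr (R : realType) n
    (nu : probability (borel_cV R n) R) (u : 'cV[R]_n) (c k : R) :
  (0 < n)%N -> sphere_uniform nu -> enorm u = 1 -> 0 <= c -> 0 <= k ->
  (\int[nu]_v (c + k * dotp u v ^+ 2)%:E = (c + k / n%:R)%:E)%E.
Proof.
move=> n0 nuU u1 c0 k0; have mu2 := measurable_dotp_sqr u.
rewrite (ge0_integralD_EFin nu (F := cst c))//; last 2 first.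
- by move=> v; rewrite mulr_ge0// sqr_ge0.
- exact: measurable_funM.
rewrite (integral_cst nu measurableT c%:E).
rewrite [X in (_ * X + _)%E](_ : _ = 1%E); last exact: probability_setT.
under [X in (_ + X)%E]eq_integral do rewrite EFinM.
rewrite ge0_integralZl//.
- by rewrite (sphere_second_moment n0 nuU u1) mule1 -EFinM -EFinD.
- exact/measurable_EFinP.
- by move=> v _; rewrite lee_fin sqr_ge0.
Qed.

(* Averaging over the reflection [v |-> v - 2 <u, v> u] turns the cross term into a
   difference of values of [h] at distance [2 mu |<u, v>|], which saves the factor
   [sqrt n] lost by a direct Cauchy-Schwarz bound. *)
Lemma reflected_two_point_le (R : realType) n (L mu r : R)
    (h : 'cV[R]_n -> R) (x u v : 'cV[R]_n) :
  0 <= L -> 0 < mu -> 0 <= r -> enorm u = 1 -> elipschitz_fun L h ->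
  enorm (r *: u + two_point mu h x v) ^+ 2 +
  enorm (r *: u + two_point mu h x (reflection u *m v)) ^+ 2 <=
  2 * r ^+ 2 + 4 * r * n%:R * L * dotp u v ^+ 2 +
  (enorm (two_point mu h x v) ^+ 2 +
   enorm (two_point mu h x (reflection u *m v)) ^+ 2).
Proof.
move=> L0 mu0 r0 u1 hL; set w := reflection u *m v.
have uu : dotp u u = 1 by rewrite -enorm_sqr u1 expr1n.
have wE : w = v - (2 * dotp u v) *: u by rewrite /w reflectionE uu divr1.
clearbody w; set t := dotp u v in wE *.
(* For either sign of [s] the two arguments differ by a vector of length [2 * mu * |t|]. *)
have diff s : `|s| = mu ->
    `|h (x + s *: v) - h (x + s *: w)| <= 2 * L * mu * `|t|.
  move=> smu; apply: (le_trans (elipschitz_fun_shift x s hL v _)).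
  rewrite wE opprB addrCA subrr addr0 enormZ u1 mulr1 smu normrM (ger0_norm (ler0n _ 2)).
  by rewrite le_eqVlt; apply/orP; left; apply/eqP; ring.
(* Since [dotp u w = - t], the two terms combine into differences of [h] between [v] and [w]. Each
   is at most [2 * L * mu * |t|], and the outer factor [t] makes the total quadratic in [t]. *)
have cross : dotp u (two_point mu h x v) + dotp u (two_point mu h x w) <=
    2 * n%:R * L * t ^+ 2.
  have tw : dotp u w = - t by rewrite wE dotpBr dotpZr uu /t; ring.
  rewrite /two_point !dotpZr tw -/t.
  have dp := diff mu (gtr0_norm mu0).
  have dm : `|- mu| = mu by rewrite normrN gtr0_norm.
  move/diff: dm; rewrite !scaleNr => dm.
  set hp := h _ in dp *; set hw := h (x + mu *: w) in dp *.
  set hm := h _ in dm *; set hmw := h (x - mu *: w) in dm *.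
  have -> : n%:R / (2 * mu) * (hp - hm) * t + n%:R / (2 * mu) * (hw - hmw) * - t =
      n%:R / (2 * mu) * (((hp - hw) - (hm - hmw)) * t) by ring.
  have -> : 2 * n%:R * L * t ^+ 2 =
      n%:R / (2 * mu) * (4 * L * mu * `|t| * `|t|).
    have -> : t ^+ 2 = `|t| * `|t| by rewrite -normrM -expr2 ger0_norm ?sqr_ge0.
    by field; rewrite gt_eqF.
  apply: ler_wpM2l; first by rewrite divr_ge0 ?mulr_ge0// ltW.
  apply: (le_trans (ler_norm _)); rewrite normrM ler_wpM2r//.
  apply: (le_trans (ler_normB _ _)); lra.
have sqrE z : enorm (r *: u + z) ^+ 2 = r ^+ 2 + 2 * (r * dotp u z) + enorm z ^+ 2.
  rewrite !enorm_sqr !(dotpDl, dotpDr, dotpZl, dotpZr) uu (dotpC z u); ring.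
rewrite !sqrE; move: (ler_wpM2l r0 cross); rewrite mulrDr.
set p := r * dotp u _; set p' := r * dotp u _.
have -> : r * (2 * n%:R * L * t ^+ 2) = (4 * r * n%:R * L * t ^+ 2) / 2 by field.
lra.
Qed.

(** Integrating the reflected inequality doubles both second moments, because [nu] is invariant
    under the reflection. The mean of [dotp u v ^+ 2] is [1 / n], which cancels the factor [n] of
    the cross term; halving gives the claim. *)
Lemma shifted_two_point_second_moment (R : realType) n (k2 L mu : R)
    (h : 'cV[R]_n -> R) (x a : 'cV[R]_n) (nu : probability (borel_cV R n) R) :
  (0 < n)%N -> shamir_constant k2 -> sphere_uniform nu -> 0 <= L -> 0 < mu ->
  elipschitz_fun L h ->
  (\int[nu]_v (enorm (a + two_point mu h x v) ^+ 2)%:E <=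
   (k2 * n%:R * L ^+ 2 + enorm a ^+ 2 + 2 * enorm a * L)%:E)%E.
Proof.
move=> n0 sh nuU L0 mu0 hL.
have [u u1 ->] := unit_direction a n0.
rewrite enormZ u1 mulr1 ger0_norm ?enorm_ge0//.
move: (enorm a) (enorm_ge0 a) => {a} r r0.
have QQ := reflection_orthogonal u.
have mQ := measurable_mulmx_borel_cV QQ.
pose F v := enorm (r *: u + two_point mu h x v) ^+ 2.
pose S v := enorm (two_point mu h x v) ^+ 2.
have le_sum (v : 'cV[R]_n) : F v + F (reflection u *m v) <=
    2 * r ^+ 2 + 4 * r * n%:R * L * dotp u v ^+ 2 + (S v + S (reflection u *m v)).
  exact: reflected_two_point_le.
have F0 v : 0 <= F v by exact: sqr_ge0.
have S0 v : 0 <= S v by exact: sqr_ge0.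
have mF : measurable_fun setT (F : borel_cV R n -> R).
  exact: measurable_shifted_two_point hL.
have mS : measurable_fun setT (S : borel_cV R n -> R).
  have := measurable_shifted_two_point mu x 0 hL.
  by under eq_fun do rewrite add0r.
have intS : (\int[nu]_v (S v)%:E <= (k2 * n%:R * L ^+ 2)%:E)%E by exact: sh.
have intFQ := sphere_uniform_invariant nuU QQ F0 mF.
have intSQ := sphere_uniform_invariant nuU QQ S0 mS.
change (\int[nu]_v (F v)%:E <=
  (k2 * n%:R * L ^+ 2 + r ^+ 2 + 2 * r * L)%:E)%E.
clearbody F S.
have mFQ := measurableT_comp mF mQ.
have mSQ := measurableT_comp mS mQ.
have c0 : 0 <= 2 * r ^+ 2 by rewrite mulr_ge0 ?sqr_ge0.
have k0 : 0 <= 4 * r * n%:R * L by rewrite !mulr_ge0.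
have mq : measurable_fun setT ((fun v => 2 * r ^+ 2 +
    4 * r * n%:R * L * dotp u v ^+ 2) : borel_cV R n -> R).
  apply: measurable_funD; first exact: measurable_cst.
  by apply: measurable_funM; [exact: measurable_cst|exact: measurable_dotp_sqr].
have q0 v : 0 <= 2 * r ^+ 2 + 4 * r * n%:R * L * dotp u v ^+ 2.
  by rewrite addr_ge0// mulr_ge0// sqr_ge0.
have int2F : (\int[nu]_v (F v)%:E + \int[nu]_v (F v)%:E <=
    (2 * r ^+ 2 + 4 * r * n%:R * L / n%:R)%:E +
    (\int[nu]_v (S v)%:E + \int[nu]_v (S v)%:E))%E.
  (* One copy of each doubled integral is replaced by its reflected form, so that the pointwise
     bound [le_sum] can be integrated. *)
  rewrite -{2}intFQ -{2}intSQ -(integral_affine_dotp_sqr n0 nuU u1 c0 k0).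
  rewrite -(ge0_integralD_EFin nu F0 (fun v => F0 _) mF mFQ).
  rewrite -(ge0_integralD_EFin nu S0 (fun v => S0 _) mS mSQ).
  rewrite -(ge0_integralD_EFin nu q0 (fun v => addr_ge0 (S0 v) (S0 _)) mq
    (measurable_funD mS mSQ)).
  apply: ge0_le_integral => //.
  - by move=> v _; rewrite lee_fin addr_ge0.
  - by apply/measurable_EFinP; exact: measurable_funD mF mFQ.
  - by apply/measurable_EFinP; exact: measurable_funD mq (measurable_funD mS mSQ).
  - by move=> v _; rewrite lee_fin; exact: le_sum.
rewrite mulrAC mulfK ?pnatr_eq0 -?lt0n// in int2F.
have {int2F intS} : (\int[nu]_v (F v)%:E + \int[nu]_v (F v)%:E <=
    (2 * (k2 * n%:R * L ^+ 2 + r ^+ 2 + 2 * r * L))%:E)%E.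
  apply: (le_trans int2F); apply: (le_trans (leeD2l _ (leeD intS intS))).
  by rewrite -!EFinD lee_fin; lra.
have : (0 <= \int[nu]_v (F v)%:E)%E.
  by apply: integral_ge0 => v _; rewrite lee_fin.
(* The upper bound excludes the value [+oo] and nonnegativity excludes [-oo]; only then can the
   inequality be halved. *)
case: (\int[nu]_v _)%E => //= I _.
by rewrite !lee_fin; lra.
Qed.

(** * The two gradient estimators: reduction, Lipschitz constants, measurability *)

(** The transposed Jacobian estimate applied to a vector [c] is the two-point estimator of
    [dotp c (ystar z)] as a function of [z]; here [c] is the partial gradient in [y], frozen at
    [x]. *)
Lemma grad_estimateE (R : realType) n m (mu : R)
    (f : 'cV[R]_n -> 'cV[R]_m -> R) (ystar : 'cV[R]_n -> 'cV[R]_m) x v :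
  grad_estimate mu f ystar x v = gradx f x (ystar x) +
    two_point mu (fun z => dotp (grady f x (ystar x)) (ystar z)) x v.
Proof.
congr (_ + _); rewrite /jac_estimate /two_point linearZ /= trmx_mul trmxK.
rewrite -scalemxAl -mulmxA [(_ - _)^T *m _]mx11_scalar -dotpE mul_mx_scalar.
by rewrite scalerA -dotpBr dotpC.
Qed.

Lemma dotp_comp_elipschitz (R : realType) n m (Lf L : R) (c : 'cV[R]_m)
    (y : 'cV[R]_n -> 'cV[R]_m) :
  enorm c <= Lf -> elipschitz L y ->
  elipschitz_fun (Lf * L) (fun z => dotp c (y z)).
Proof.
move=> cL yL x x'; apply: (le_trans (dotp_elipschitz c _ _)).
rewrite -mulrA; apply: ler_pM => //; exact: enorm_ge0.
Qed.

Lemma elipschitz_coord (R : realType) n m (L : R) (y : 'cV[R]_n -> 'cV[R]_m) i :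
  elipschitz L y -> elipschitz_fun L (fun z => y z i ord0).
Proof.
move=> yL x x'; apply: le_trans (yL x x').
by have := enorm_ge_coord (y x - y x') i; rewrite !mxE.
Qed.

Lemma elipschitz_ge0 (R : realType) n m (L : R) (y : 'cV[R]_n -> 'cV[R]_m) :
  (0 < n)%N -> elipschitz L y -> 0 <= L.
Proof.
move=> n0 /(_ (delta_mx (Ordinal n0) ord0) 0).
by rewrite subr0 enorm_delta mulr1; apply: le_trans; exact: enorm_ge0.
Qed.

(** By Pythagoras the squared distance of two points of the graph of [y] is at most [1 + L ^+ 2]
    times that of their first components. *)
Lemma graph_elipschitz (R : realType) n m (Lf L : R)
    (f : 'cV[R]_n -> 'cV[R]_m -> R) (y : 'cV[R]_n -> 'cV[R]_m) :
  0 <= Lf -> 0 <= L -> elipschitz_fun2 Lf f -> elipschitz L y ->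
  elipschitz_fun (Lf * Num.sqrt (1 + L ^+ 2)) (fun z => f z (y z)).
Proof.
move=> Lf0 L0 fL yL x x'; apply: (le_trans (fL _ _ _ _)).
rewrite -mulrA ler_wpM2l//.
have LL : 0 <= 1 + L ^+ 2 by rewrite addr_ge0// sqr_ge0.
rewrite -(ler_pXn2r (n := 2))// ?nnegrE ?mulr_ge0 ?sqrtr_ge0 ?enorm_ge0//.
rewrite exprMn [Num.sqrt (1 + _) ^+ 2]sqr_sqrtr// enorm_sqr dotp_col_mx.
rewrite -!enorm_sqr mulrDl mul1r lerD2l.
by rewrite -exprMn lerXn2r ?nnegrE ?mulr_ge0 ?enorm_ge0.
Qed.

(** Caratheodory's criterion: measurable in [v] by the two-point form, and continuous in [x] because
    both the gradients along the graph of [ystar] and [ystar] itself are Lipschitz. *)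
Lemma grad_estimate_measurable (R : realType) n m (Lf Lg Ly mu : R)
    (f : 'cV[R]_n -> 'cV[R]_m -> R) (ystar : 'cV[R]_n -> 'cV[R]_m) :
  (forall x y, enorm (grady f x y) <= Lf) -> gradient_elipschitz Lg f ->
  elipschitz Ly ystar ->
  measurable_fun setT (fun p : borel_cV R n * borel_cV R n =>
    enorm (grad_estimate mu f ystar p.1 p.2) ^+ 2).
Proof.
move=> fyL fg yL.
apply: (@caratheodory_measurable _ _ _ _
  (fun x (v : borel_cV R n) => enorm (grad_estimate mu f ystar x v) ^+ 2)) => [v|x]; last first.
  under eq_fun do rewrite grad_estimateE.
  exact: measurable_shifted_two_point (dotp_comp_elipschitz (fyL x (ystar x)) yL).
(* The hypothesis controls the two partial gradients jointly, so they are stacked first and split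
   into coordinates afterwards. Absolute values allow constants of any sign. *)
have gL : elipschitz (`|Lg| * (1 + `|Ly|))
    (fun x => col_mx (gradx f x (ystar x)) (grady f x (ystar x))).
  move=> x x'; apply: (le_trans (fg _ _ _ _)).
  apply: (@le_trans _ _ (`|Lg| * enorm (col_mx (x - x') (ystar x - ystar x')))).
    by rewrite ler_wpM2r ?enorm_ge0// ler_norm.
  rewrite -mulrA ler_wpM2l// (le_trans (enorm_col_mx_le _ _))// mulrDl mul1r lerD2l.
  by rewrite (le_trans (yL _ _))// ler_wpM2r ?enorm_ge0// ler_norm.
have gxc i : continuous (fun x : 'cV[R]_n => gradx f x (ystar x) i ord0).
  have := elipschitz_fun_continuous (elipschitz_coord (lshift m i) gL).
  by under eq_fun do rewrite col_mxEu.
have gyc i : continuous (fun x : 'cV[R]_n => grady f x (ystar x) i ord0).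
  have := elipschitz_fun_continuous (elipschitz_coord (rshift n i) gL).
  by under eq_fun do rewrite col_mxEd.
have yc s i : continuous (fun x : 'cV[R]_n => ystar (x + s *: v) i ord0).
  apply: (@elipschitz_fun_continuous _ _ Ly) => x x'.
  have := elipschitz_coord i yL (x + s *: v) (x' + s *: v).
  by rewrite opprD addrACA subrr addr0.
have yc' s i : continuous (fun x : 'cV[R]_n =>
    (ystar (x + s *: v) - ystar (x + (- s) *: v)) i ord0).
  rewrite (_ : (fun _ => _) = fun x : 'cV[R]_n =>
      ystar (x + s *: v) i ord0 - ystar (x + (- s) *: v) i ord0).
    by move=> x; exact: cvgB (yc s i x) (yc (- s) i x).
  by apply/funext => x; rewrite !mxE.
have gec i : continuous (fun x : 'cV[R]_n => grad_estimate mu f ystar x v i ord0).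
  rewrite (_ : (fun _ => _) = fun x : 'cV[R]_n => gradx f x (ystar x) i ord0 +
      n%:R / (2 * mu) * dotp (grady f x (ystar x))
        (ystar (x + mu *: v) - ystar (x + (- mu) *: v)) *
        (v : 'cV[R]_n) i ord0); last first.
    by apply/funext => x; rewrite grad_estimateE mxE [X in _ + X]mxE -dotpBr scaleNr.
  move=> x; apply: (cvgD (gxc i x)).
  exact: cvgM (cvgM (cvg_cst _) (continuous_dotp gyc (yc' mu) (x := x))) (cvg_cst _).
by under eq_fun do rewrite enorm_sqr; exact: continuous_dotp.
Qed.

Lemma two_point_measurable (R : realType) n (L mu : R) (h : 'cV[R]_n -> R) :
  elipschitz_fun L h ->
  measurable_fun setT (fun p : borel_cV R n * borel_cV R n =>
    enorm (two_point mu h p.1 p.2) ^+ 2).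
Proof.
move=> hL.
apply: (@caratheodory_measurable _ _ _ _
  (fun x (v : borel_cV R n) => enorm (two_point mu h x v) ^+ 2)) => [v|x]; last first.
  have := measurable_shifted_two_point mu x 0 hL.
  by under eq_fun do rewrite add0r.
have hc s : continuous (fun x : 'cV[R]_n => h (x + s *: v)).
  apply: (@elipschitz_fun_continuous _ _ L) => x x'.
  by have := hL (x + s *: v) (x' + s *: v); rewrite opprD addrACA subrr addr0.
have tc i : continuous (fun x : 'cV[R]_n => two_point mu h x v i ord0).
  rewrite (_ : (fun _ => _) = fun x : 'cV[R]_n =>
      n%:R / (2 * mu) * (h (x + mu *: v) - h (x + (- mu) *: v)) *
        (v : 'cV[R]_n) i ord0); last first.
    by apply/funext => x; rewrite mxE scaleNr.
  by move=> x; exact: cvgM (cvgM (cvg_cst _) (cvgB (hc mu x) (hc (- mu) x))) (cvg_cst _).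
by under eq_fun do rewrite enorm_sqr; exact: continuous_dotp.
Qed.

(** * The conditional second moment bounds *)

Theorem lemma1 (R : realType) (dx dy : nat)
  (f : 'cV[R]_dx -> 'cV[R]_dy -> R)
  (G : 'cV[R]_dx -> 'cV[R]_dy -> 'cV[R]_dy)
  (Y : set 'cV[R]_dy)
  (ystar : 'cV[R]_dx -> 'cV[R]_dy)
  (x0 : 'cV[R]_dx) (Delta Lf Lg Ly k2 mu : R)
  (d : measure_display) (T : measurableType d) (P : probability T R)
  (xt vt : {RV P >-> borel_cV R dx})
  (dx_ge1 : (1 <= dx)%N) (dy_ge1 : (1 <= dy)%N)
  (Y_closed : closed Y)
  (Y_convex : convex_set (Y : set (convex_lmodType 'cV[R]_dy)))
  (ystar_unique_sol : forall x y, vi_solution G Y x y <-> y = ystar x)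
  (Delta_gt0 : 0 < Delta)
  (init_gap : ((f x0 (ystar x0))%:E
     - ereal_inf (range (fun x => (f x (ystar x))%:E)) <= Delta%:E)%E)
  (f_lipschitz : elipschitz_fun2 Lf f)
  (gradx_bound : forall x y, enorm (gradx f x y) <= Lf)
  (grady_bound : forall x y, enorm (grady f x y) <= Lf)
  (f_diff : forall p : 'cV[R]_dx * 'cV[R]_dy,
     differentiable (fun q : 'cV[R]_dx * 'cV[R]_dy => f q.1 q.2) p)
  (f_grad_lipschitz : gradient_elipschitz Lg f)
  (ystar_lipschitz : elipschitz Ly ystar)
  (k2_shamir : shamir_constant k2)
  (mu_gt0 : 0 < mu)
  (vt_uniform : sphere_uniform (distribution P vt))
  (xt_vt_indep : independent_RV xt vt) :
  let g w := grad_estimate mu f ystar (xt w) (vt w) in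
  let gtilde w := zo_grad_estimate mu f ystar (xt w) (vt w) in
  let b := k2 * dx%:R * Lf ^+ 2 * Ly ^+ 2 + Lf ^+ 2 * (1 + 2 * Ly) in
  let btilde := k2 * dx%:R * Lf ^+ 2 * Ly ^+ 2
                + k2 * dx%:R * Lf ^+ 2 * (1 + 2 * Ly) in
  [/\ 1 <= k2,
      (exists Z, cond_expectation xt (fun w => enorm (g w) ^+ 2) Z) /\
      (forall Z, cond_expectation xt (fun w => enorm (g w) ^+ 2) Z ->
         {ae P, forall w, Z w <= b}),
      (exists Z, cond_expectation xt (fun w => enorm (gtilde w) ^+ 2) Z) /\
      (forall Z, cond_expectation xt (fun w => enorm (gtilde w) ^+ 2) Z ->
         {ae P, forall w, Z w <= btilde})
    & b <= btilde].
Proof.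
move=> g gtilde b btilde.
have Ly0 := elipschitz_ge0 dx_ge1 ystar_lipschitz.
have Lf0 : 0 <= Lf by apply: le_trans (gradx_bound 0 0); exact: enorm_ge0.
have k21 : 1 <= k2 := shamir_constant_ge1 dx_ge1 vt_uniform k2_shamir.
have dx1 : 1 <= dx%:R :> R by rewrite ler1n.
have kdx : 1 <= k2 * dx%:R by rewrite mulr_ege1.
have kdx0 : 0 <= k2 * dx%:R := le_trans ler01 kdx.
have Lf2 : 0 <= Lf ^+ 2 by exact: sqr_ge0.
split => //.
- apply: (@cond_expectation_indep _ _ _ _ _ _ _ _ xt vt
    (fun x v => enorm (grad_estimate mu f ystar x v) ^+ 2) b xt_vt_indep).
  + exact: grad_estimate_measurable grady_bound f_grad_lipschitz ystar_lipschitz.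
  + by move=> x v; exact: sqr_ge0.
  move=> x; under eq_integral do rewrite grad_estimateE.
  set a := gradx f x (ystar x); have aL : enorm a <= Lf by exact: gradx_bound.
  apply: (le_trans (shifted_two_point_second_moment x a dx_ge1 k2_shamir vt_uniform
    (mulr_ge0 Lf0 Ly0) mu_gt0
    (dotp_comp_elipschitz (grady_bound x (ystar x)) ystar_lipschitz))).
  (* The first summands agree; [enorm a <= Lf] bounds the square by [Lf ^+ 2] and the cross term by
     [2 * Lf ^+ 2 * Ly]. *)
  rewrite lee_fin /b exprMn !mulrA -addrA lerD2l mulrDr mulr1.
  apply: lerD; first by rewrite lerXn2r ?nnegrE ?enorm_ge0.
  rewrite (_ : Lf ^+ 2 * (2 * Ly) = 2 * Lf * Lf * Ly); last by ring.
  by rewrite !ler_wpM2r// ler_wpM2l.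
- have hL := graph_elipschitz Lf0 Ly0 f_lipschitz ystar_lipschitz.
  apply: (@cond_expectation_indep _ _ _ _ _ _ _ _ xt vt
    (fun x v => enorm (zo_grad_estimate mu f ystar x v) ^+ 2) btilde xt_vt_indep).
  + exact: two_point_measurable hL.
  + by move=> x v; exact: sqr_ge0.
  move=> x; apply: (le_trans (k2_shamir _ _ _ _ x _ dx_ge1 _ mu_gt0 hL vt_uniform)).
    by rewrite mulr_ge0// sqrtr_ge0.
  (* The bound obtained has the factor [1 + Ly ^+ 2], while [btilde] amounts to [(1 + Ly) ^+ 2], so
     the surplus is the term linear in [Ly]. *)
  rewrite lee_fin exprMn sqr_sqrtr ?addr_ge0 ?sqr_ge0// -subr_ge0.
  rewrite (_ : _ - _ = 2 * (k2 * dx%:R) * Lf ^+ 2 * Ly); last by rewrite /btilde; ring.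
  by rewrite mulr_ge0// mulr_ge0// mulr_ge0.
(* Only the second summands differ, by the factor [k2 * dx%:R], which is at least 1. *)
- rewrite lerD2l ler_wpM2r ?addr_ge0 ?mulr_ge0//.
  by rewrite ler_peMl.
Qed.
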